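(* Let $W$ be a graded CLSAS on $\mathcal{W}$. There exists a bilinear form $\phi:W\times W\to\mathbb{C}$ satisfying (i) $\phi(xy,z)-\phi(x,yz)=\phi(yx,z)-\phi(y,xz)$ for all $x,y,z\in W$, and (ii) $\phi(L_a,L_b)-\phi(L_b,L_a)=\frac{1}{12}(b^3-b)\delta_{a+b,0}$ for all $a,b\in G$ (i.e. the central extension $\hat W=W\oplus\mathbb{C}K$ with product $(x+sK)\ast(y+tK)=xy+\phi(x,y)K$ is a left-symmetric algebra whose sub-adjacent Lie algebra is the high rank Virasoro algebra $\mathcal{V}$), if and only if $W=V_{0,\theta}$ for some $\theta\in\mathbb{C}$ with $\theta\neq0$ and $\theta^{-1}\notin G$. In that case $\phi$ is uniquely determined and given by $$\phi(L_a,L_b)=\frac{1}{24}\big(b^3-b-(\theta-\theta^{-1})b^2\big)\delta_{a+b,0}\qquad(a,b\in G).$$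
   Context: $G$ is a free (additive) subgroup of $\mathbb{C}$ of rank $\nu>1$. The high rank Witt algebra $\mathcal{W}$ has basis $\{L_a\mid a\in G\}$ and bracket $[L_a,L_b]=(b-a)L_{a+b}$; the high rank Virasoro algebra $\mathcal{V}$ has basis $\{L_a\mid a\in G\}\cup\{K\}$, $K$ central, and $[L_a,L_b]=(b-a)L_{a+b}+\frac{K}{12}(b^3-b)\delta_{a+b,0}$. A left-symmetric algebra is a complex vector space with bilinear product satisfying $(xy)z-x(yz)=(yx)z-y(xz)$; a compatible left-symmetric algebraic structure (CLSAS) on a Lie algebra $\mathfrak g$ is such a product on $\mathfrak g$ with $xy-yx=[x,y]$. A CLSAS on $\mathcal{W}$ is graded if $L_aL_b=f(a,b)L_{a+b}$ for some function $f:G\times G\to\mathbb{C}$. For $\alpha,\theta\in\mathbb{C}$ with $\theta=0$ or $\theta^{-1}\notin G$, $V_{\alpha,\theta}$ is the graded CLSAS with $L_bL_c=\frac{(\alpha+c+\alpha\theta b)(1+\theta c)}{1+\theta(b+c)}L_{b+c}$; thus $V_{0,\theta}$ has $L_bL_c=\frac{c(1+\theta c)}{1+\theta(b+c)}L_{b+c}$. *)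

(* Defs.v *)
(* The complex numbers are modelled by an arbitrary
   numClosedFieldType C (algebraically closed, characteristic 0). *)
From HB Require Import structures.
From mathcomp Require Import all_boot all_order all_algebra.
Set Implicit Arguments. Unset Strict Implicit. Unset Printing Implicit Defensive.
Import Order.TTheory GRing.Theory Num.Theory.
Local Open Scope ring_scope.

Section Defs.
Variable C : numClosedFieldType.

Definition inG (nu : nat) (g : 'I_nu -> C) (x : C) : Prop :=
  exists n : 'I_nu -> int, x = \sum_(i < nu) g i *~ n i.

Definition Zfree (nu : nat) (g : 'I_nu -> C) : Prop :=
  forall n : 'I_nu -> int, \sum_(i < nu) g i *~ n i = 0 -> forall i, n i = 0.

Definition delta0 (x : C) : C := (x == 0)%:R.

(* A graded CLSAS on the Witt algebra W with basis L_a (a in G):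
   L_a L_b = f a b L_(a+b); left-symmetry and compatibility with
   [L_a, L_b] = (b - a) L_(a+b), written on basis elements. *)
Definition graded_CLSAS (G : C -> Prop) (f : C -> C -> C) : Prop :=
  (forall a b c, G a -> G b -> G c ->
     f a b * f (a + b) c - f b c * f a (b + c)
     = f b a * f (b + a) c - f a c * f b (a + c))
  /\ (forall a b, G a -> G b -> f a b - f b a = b - a).

(* Conditions (i) and (ii) on the bilinear form phi with
   phi(L_a, L_b) = psi a b, written on basis elements. *)
Definition virasoro_ext_form (G : C -> Prop) (f psi : C -> C -> C) : Prop :=
  (forall a b c, G a -> G b -> G c ->
     f a b * psi (a + b) c - f b c * psi a (b + c)
     = f b a * psi (b + a) c - f a c * psi b (a + c))
  /\ (forall a b, G a -> G b ->
     psi a b - psi b a = 12%:R^-1 * (b ^+ 3 - b) * delta0 (a + b)).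

Definition V0 (theta b c : C) : C :=
  c * (1 + theta * c) / (1 + theta * (b + c)).

Definition phi_theta (theta a b : C) : C :=
  24%:R^-1 * (b ^+ 3 - b - (theta - theta^-1) * b ^+ 2) * delta0 (a + b).

End Defs.

(* Main.v *)
(* Write F(a) for f(a, -a) and P(a) for phi(L_a, L_(-a)). Left-symmetry makes F
   satisfy the same degree-zero identity as P, so (F, P) is a vector-valued
   solution whose skew part is known.

   If f(0, 0) <> 0, then {a | f(a, 0) = f(0, 0)} behaves like a positive cone on
   the multiples of a generic x, which determines f there and contradicts
   left-symmetry. Otherwise f(a, 0) = 0 and f(0, a) = a. The relations between
   L_a, L_(-a), L_(2a), L_(-2a) on the multiples of a then leave one parameter
   q, and the skew parts give F(a) = -a + T a^2 and
   24 P(a) + F(a) = -a^3 + a^2 / T, with T = T(a) = (1 + q) / ((1 - q) a) even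
   and T(2a) = T(a). Comparing F and P on triples a + b + c = 0 shows that sigma(a) = (a / T(a))^2 satisfies
   a(b - c) sigma(a) + b(c - a) sigma(b) + c(a - b) sigma(c) = 0, which with
   sigma(2a) = 4 sigma(a) forces sigma(a) = a^2 sigma(g) / g^2, i.e.
   T = theta or -theta pointwise. The sign is constant because
   f(-a, y) f(a, y - a) - y^2 + a y depends only on the coset y + Z a. *)
Require Import Defs.
From HB Require Import structures.
From mathcomp Require Import all_boot all_order all_algebra.
From mathcomp Require Import ring.
Import Order.TTheory GRing.Theory Num.Theory.
Local Open Scope ring_scope.

Set Implicit Arguments.
Unset Strict Implicit.
Unset Printing Implicit Defensive.

(** * Equations as explicit linear combinations of hypotheses *)

Lemma lincomb1 (R : comNzRingType) (k l1 r1 l r : R) :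
  l1 = r1 -> l - r = k * (l1 - r1) -> l = r.
Proof. by move=> -> /eqP; rewrite subrr mulr0 subr_eq0 => /eqP. Qed.

Lemma lincomb2 (R : comNzRingType) (k1 k2 l1 r1 l2 r2 l r : R) :
  l1 = r1 -> l2 = r2 -> l - r = k1 * (l1 - r1) + k2 * (l2 - r2) -> l = r.
Proof.
by move=> -> -> /eqP; rewrite !subrr !mulr0 addr0 subr_eq0 => /eqP.
Qed.

Arguments lincomb1 {R} k {l1 r1 l r}.
Arguments lincomb2 {R} k1 k2 {l1 r1 l2 r2 l r}.

(** * Left-symmetry and its degree-zero part *)

Section GradedCLSAS.
Variables (C : numClosedFieldType) (G : C -> Prop) (f : C -> C -> C).
Hypotheses (G0 : G 0) (GD : forall a b, G a -> G b -> G (a + b))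
  (GN : forall a, G a -> G (- a)).
Hypothesis HW : graded_CLSAS G f.

Let HWls := proj1 HW.
Let HWcomp := proj2 HW.

Lemma group_natmul n a : G a -> G (n%:R * a).
Proof.
move=> Ga; elim: n => [|n IH]; first by rewrite mul0r.
by rewrite -natr1 mulrDl mul1r; exact: GD.
Qed.

Ltac in_group := first [ eassumption | apply: GN; in_group
  | apply: group_natmul; in_group | apply: GD; in_group ].

Lemma f_swap a b : G a -> G b -> f b a = f a b + (a - b).
Proof.
by move=> Ga Gb; apply: (lincomb1 (-1) (HWcomp Ga Gb)); ring.
Qed.

(** Compatibility merges the two terms at [a + b] into [b - a]. The sums are separate variables so
    that an instance can name them in simplified form. *)
Lemma left_symmetry a b c d e s : G a -> G b -> G c ->
  d = a + b -> e = b + c -> s = a + c ->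
  (b - a) * f d c = f b c * f a e - f a c * f b s.
Proof.
move=> Ga Gb Gc -> -> ->.
have H := HWls Ga Gb Gc.
rewrite (addrC b a) in H.
by apply: (lincomb2 1 (- f (a + b) c) H (HWcomp Ga Gb)); ring.
Qed.

(* The degree-zero part of condition (i), with [v x] standing for
   [phi (L_x, L_(-x))]; the coefficient of [L_0] in [L_x L_(-x)] satisfies
   the same identity, by left-symmetry. *)
Definition degree0_form (v : C -> C) := forall a b c d, G a -> G b ->
  c = - (a + b) -> d = a + b -> (b - a) * v d = f b c * v a - f a c * v b.

Definition antidiag (psi : C -> C -> C) (x : C) : C := psi x (- x).

Lemma degree0_form_f : degree0_form (antidiag f).
Proof.
move=> a b c d Ga Gb -> ->; rewrite /antidiag.
by apply: left_symmetry; try ring; in_group.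
Qed.

Lemma degree0_form_ext psi :
  virasoro_ext_form G f psi -> degree0_form (antidiag psi).
Proof.
move=> [Hls _] a b c d Ga Gb -> ->; rewrite /antidiag.
have := Hls a b (- (a + b)) Ga Gb; rewrite (addrC b a).
have -> : b + - (a + b) = - a by ring.
have -> : a + - (a + b) = - b by ring.
move=> /(_ ltac:(in_group)) H1.
by apply: (lincomb2 1 (- psi (a + b) (- (a + b))) H1 (HWcomp Ga Gb)); ring.
Qed.

Lemma antidiag_f_swap a : G a -> antidiag f (- a) = antidiag f a + 2%:R * a.
Proof.
move=> Ga; rewrite /antidiag opprK f_swap //; [ring | in_group].
Qed.

Lemma antidiag_ext_swap psi a : virasoro_ext_form G f psi -> G a ->
  antidiag psi (- a) = antidiag psi a - 12%:R^-1 * (a - a ^+ 3).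
Proof.
move=> [_ Hcomp] Ga; rewrite /antidiag opprK.
have := Hcomp a (- a) Ga ltac:(in_group); rewrite /delta0 subrr eqxx mulr1 => E.
by apply: (lincomb1 (-1) E); field.
Qed.

(** * Right multiplication by [L_0] *)

Lemma f_0l c : G c -> f 0 c = f c 0 + c.
Proof. by move=> Gc; rewrite f_swap // subr0. Qed.

(** Left multiplication by [L_0] has eigenvalue [f c 0 + c] on [L_c], and by left-symmetry [L_b]
    must shift it by exactly [b] unless [L_b L_c] vanishes. *)
Lemma f_support b c : G b -> G c -> f b c * (f (b + c) 0 - f c 0) = 0.
Proof.
move=> Gb Gc.
have E : (b - 0) * f b c = f b c * f 0 (b + c) - f 0 c * f b c.
  by apply: left_symmetry => //; ring.
rewrite !f_0l // in E; last by in_group.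
by apply: (lincomb1 (-1) E); ring.
Qed.

Lemma f_r0 b : G b -> f b 0 = 0 \/ f b 0 = f 0 0.
Proof.
move=> Gb; have /eqP := f_support Gb G0; rewrite addr0 mulf_eq0 subr_eq0.
by case/orP => /eqP; [left | right].
Qed.

Lemma natr_mul_neq0 n (a : C) : a != 0 -> n.+1%:R * a != 0.
Proof. by move=> a0; rewrite mulf_neq0 // pnatr_eq0. Qed.

Lemma sqr_eq_natmul m n (a : C) : a != 0 ->
  (m%:R * a) ^+ 2 = (n%:R * a) ^+ 2 -> m = n.
Proof.
move=> a0; rewrite !exprMn => /(mulIf (expf_neq0 2 a0)) /eqP.
by rewrite -!natrX eqr_nat eqn_exp2r // => /eqP.
Qed.

(** If [f a 0] and [f (- a) 0] both equal [f 0 0], the degree-zero identity with [L_0] makes [P] the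
    multiple [psi 0 0 / f 0 0] of [F] at [a] and at [- a]; the two skew parts then force
    [a ^+ 2 = k]. *)
Lemma f_r0_exclusive psi : virasoro_ext_form G f psi -> f 0 0 != 0 ->
  exists k, forall a, G a -> a != 0 -> a ^+ 2 != k ->
    f a 0 = f 0 0 -> f (- a) 0 = 0.
Proof.
move=> H al0; set k := 1 + 24%:R * psi 0 0 / f 0 0; exists k => a Ga a0 ak ha.
have GNa : G (- a) by in_group.
case: (f_r0 GNa) => // hNa; case/eqP: ak.
have E x : G x -> f (- x) 0 * antidiag psi x = antidiag f x * psi 0 0.
  move=> Gx; have := degree0_form_ext H Gx G0 (erefl _) (erefl _).
  rewrite !addr0 f_0l => [E|]; last by in_group.
  by rewrite /antidiag oppr0 in E *; apply: (lincomb1 (-1) E); ring.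
have E1 := E a Ga; have E2 := E (- a) GNa.
rewrite opprK ha (antidiag_ext_swap H) // antidiag_f_swap // in E2.
rewrite hNa in E1.
have E3 : f 0 0 * (a - a ^+ 3) = - (24%:R * a * psi 0 0).
  apply: (lincomb2 12%:R (- 12%:R) E1 E2).
  by field.
apply: (mulfI (mulf_neq0 al0 a0)); rewrite /k.
apply: (lincomb1 (-1) E3); field; exact: al0.
Qed.

(** If both values vanished, [f_support] would kill [f a (- a)] and [f (- a) a], which differ by
    [2 a]. *)
Lemma f_r0_or a : G a -> a != 0 -> f 0 0 != 0 ->
  f a 0 = 0 -> f (- a) 0 = f 0 0.
Proof.
move=> Ga a0 al0 ha; have GNa : G (- a) by in_group.
case: (f_r0 GNa) => // hNa.
have := f_support Ga GNa; have := f_support GNa Ga.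
rewrite addNr subrr ha hNa !subr0.
move=> /eqP; rewrite mulf_eq0 (negPf al0) orbF => /eqP z1.
move=> /eqP; rewrite mulf_eq0 (negPf al0) orbF => /eqP z2.
have := antidiag_f_swap Ga; rewrite /antidiag opprK z1 z2 add0r => /esym/eqP.
by rewrite (negPf (natr_mul_neq0 1 a0)).
Qed.

(** Otherwise [f_support] kills both [f a b] and [f b a], whose difference is [b - a]. *)
Lemma f_r0_add a b : G a -> G b -> a != b ->
  f a 0 = f b 0 -> f (a + b) 0 = f a 0.
Proof.
move=> Ga Gb ab hab.
have := f_support Ga Gb; have := f_support Gb Ga.
rewrite (addrC b a) -hab => /eqP; rewrite mulf_eq0 subr_eq0.
case/orP => /eqP // z1 /eqP; rewrite mulf_eq0 subr_eq0.
case/orP => /eqP // z2; have := f_swap Ga Gb.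
by rewrite z1 z2 add0r => /esym/eqP; rewrite subr_eq0 (negPf ab).
Qed.

(** If [(j g)^2 = k] for some [j] from 1 to 4, then [5 g] works, since [(5 i g)^2 = k] would give
    [5 i = j]. *)
Lemma exists_generic_multiple (g k : C) : G g -> g != 0 ->
  exists x, [/\ G x, x != 0 & forall j, (0 < j < 5)%N -> (j%:R * x) ^+ 2 != k].
Proof.
move=> Gg g0.
have [H | /forallPn [j]] := boolP [forall j : 'I_5,
    (0 < j)%N ==> ((j%:R * g) ^+ 2 != k)].
  exists g; split=> // j /andP[j0 j5].
  by move/forallP: H => /(_ (Ordinal j5)); rewrite j0.
rewrite negb_imply negbK => /andP[j0 /eqP kj].
exists (5%:R * g); split; [in_group | exact: natr_mul_neq0 |].
move=> i /andP[i0 i5]; apply/eqP.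
rewrite -kj mulrA -natrM => /(sqr_eq_natmul g0).
case: i i0 i5 => [|[|[|[|[|i]]]]] // _ _;
by case: j j0 {kj} => [[|[|[|[|[|j]]]]] /=].
Qed.

Lemma f_00 psi g : virasoro_ext_form G f psi -> G g -> g != 0 -> f 0 0 = 0.
Proof.
move=> H Gg g0; apply/eqP; apply/negP => /negP al0.
have [k Hk] := f_r0_exclusive H al0.
have [x0 [Gx0 x00 Hx0]] := exists_generic_multiple k Gg g0.
have [x [Gx xn0 Hx hx]] : exists x, [/\ G x, x != 0,
    forall j, (0 < j < 5)%N -> (j%:R * x) ^+ 2 != k & f x 0 = f 0 0].
  case: (f_r0 Gx0) => h; last by exists x0.
  exists (- x0); split; rewrite ?oppr_eq0 //; [in_group | | exact: f_r0_or].
  by move=> j jj; rewrite mulrN sqrrN Hx0.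
have Gj j : G (j%:R * x) by in_group.
have jn0 j : j.+1%:R * x != 0 by apply: natr_mul_neq0.
have Gnj j : G (- (j%:R * x)) by in_group.
have neg j : (0 < j < 5)%N -> f (j%:R * x) 0 = f 0 0 -> f (- (j%:R * x)) 0 = 0.
  move=> jj; apply: Hk => //; last exact: Hx.
  by case: j jj => // j _; exact: natr_mul_neq0.
have neqj m n : m != n -> m%:R * x != n%:R * x.
  by move=> mn; apply/eqP => /(mulIf xn0)/eqP; rewrite eqr_nat (negPf mn).
have h1 : f (1%:R * x) 0 = f 0 0 by rewrite mul1r.
have n1 := neg 1 isT h1.
(* If [f (2 x) 0] vanished, [2 x] and [- x] would both have value 0, hence so would their sum
   [x]. *)
have h2 : f (2%:R * x) 0 = f 0 0.
  case: (f_r0 (Gj 2)) => // z.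
  have : f (2%:R * x + - (1%:R * x)) 0 = f (2%:R * x) 0.
    apply: f_r0_add => //; last by rewrite z n1.
    rewrite -subr_eq0 (_ : _ - _ = 3%:R * x) ?jn0 //; ring.
  rewrite (_ : _ + _ = 1%:R * x); last by ring.
  by rewrite h1 z.
have h3 : f (3%:R * x) 0 = f 0 0.
  rewrite (_ : 3%:R * x = 2%:R * x + 1%:R * x); last by ring.
  by rewrite f_r0_add ?h1 ?h2 ?neqj.
have h4 : f (4%:R * x) 0 = f 0 0.
  rewrite (_ : 4%:R * x = 3%:R * x + 1%:R * x); last by ring.
  by rewrite f_r0_add ?h1 ?h3 ?neqj.
have hj j : (0 < j < 5)%N -> f (j%:R * x) 0 = f 0 0.
  by case: j => [|[|[|[|[|j]]]]].
have Fj j : (0 < j < 5)%N -> antidiag f (j%:R * x) = 0.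
  move=> jj; have /eqP := f_support (Gj j) (Gnj j).
  rewrite subrr (neg j jj (hj j jj)) subr0 mulf_eq0 (negPf al0) orbF.
  by move=> /eqP.
have FNj j : (0 < j < 5)%N -> antidiag f (- (j%:R * x)) = 2%:R * (j%:R * x).
  by move=> jj; rewrite antidiag_f_swap // Fj // add0r.
(* Here [f b c = c (2 b + c) / (b + c)] on positive multiples of [x], while
   [f (- x) b = b + x]; these two violate left-symmetry. *)
have fpos i j : (0 < i < 5)%N -> (0 < j < 5)%N -> (0 < i + j < 5)%N ->
    f (i%:R * x) (j%:R * x) * (i + j)%:R = (2%:R * i%:R + j%:R) * j%:R * x.
  move=> ii jj ij.
  have := @degree0_form_f (- ((i + j)%:R * x)) (i%:R * x) (j%:R * x)
    (- (j%:R * x)) ltac:(in_group) ltac:(in_group).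
  rewrite !natrD; move=> /(_ ltac:(ring) ltac:(ring)).
  rewrite -!natrD FNj // FNj // Fj // mulr0 subr0 !natrD => E.
  apply: (mulfI (jn0 1)).
  by apply: (lincomb1 (-1) E); ring.
have fneg i : (1 < i < 5)%N -> f (- (1%:R * x)) (i%:R * x) = i.+1%:R * x.
  move=> /andP[i1 i5]; have i0 : (0 < i)%N by exact: ltnW.
  have Gi := Gj i; have Gn := Gnj 1.
  have := f_support Gi Gn.
  have -> : i%:R * x - 1%:R * x = i.-1%:R * x.
    by rewrite -mulrBl -natrB // subn1.
  rewrite n1 subr0 hj; last by case: (i) i1 i5 => [|[|[|[|[|?]]]]].
  move=> /eqP; rewrite mulf_eq0 (negPf al0) orbF => /eqP z.
  by rewrite f_swap // z -natr1; ring.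
(* With the values found above, this instance reduces to [2 x^2 = 0]. *)
have := @left_symmetry (2%:R * x) (- (1%:R * x)) (2%:R * x)
   (1%:R * x) (1%:R * x) (4%:R * x) (Gj _) (Gnj _) (Gj _).
move=> /(_ ltac:(ring) ltac:(ring) ltac:(ring)).
rewrite !fneg //.
have e12 := fpos 1%N 2%N isT isT isT; have e21 := fpos 2%N 1%N isT isT isT.
have e22 := fpos 2%N 2%N isT isT isT; rewrite /= in e12 e21 e22.
set A := f (1%:R * x) (2%:R * x) in e12 *.
set B := f (2%:R * x) (1%:R * x) in e21 *.
set D := f (2%:R * x) (2%:R * x) in e22 *.
have -> : A = 8%:R / 3%:R * x.
  apply: (mulIf (x := 3%:R)); first by rewrite pnatr_eq0.
  by rewrite e12; field.
have -> : B = 5%:R / 3%:R * x.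
  apply: (mulIf (x := 3%:R)); first by rewrite pnatr_eq0.
  by rewrite e21; field.
have -> : D = 3%:R * x.
  apply: (mulIf (x := 4%:R)); first by rewrite pnatr_eq0.
  by rewrite e22; ring.
move=> E; have : 2%:R * x ^+ 2 = 0.
  by apply: (lincomb1 1 E); field.
by apply/eqP; rewrite mulf_neq0 ?expf_neq0 ?pnatr_eq0.
Qed.

(** * Products of multiples of one element when [L_b L_0 = 0] *)

Section TrivialRightAction.
Hypothesis f_r0_eq0 : forall b, G b -> f b 0 = 0.

Lemma f_0l_id c : G c -> f 0 c = c.
Proof. by move=> Gc; rewrite f_0l // f_r0_eq0 // add0r. Qed.

(** [L_a], [L_(-a)] and [L_0] span a copy of sl2 acting by left multiplication, and [L_0] acts on
    [L_y] by [y]. *)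
Lemma sl2_relation a y d e : G a -> G y -> d = y - a -> e = y + a ->
  f a y * f (- a) e = f (- a) y * f a d + 2%:R * a * y.
Proof.
move=> Ga Gy -> ->.
have := @left_symmetry a (- a) y 0 (y - a) (a + y) Ga ltac:(in_group) Gy.
move=> /(_ ltac:(ring) ltac:(ring) ltac:(ring)).
rewrite f_0l_id // (addrC a y) => E.
by apply: (lincomb1 1 E); ring.
Qed.

(** The parameter is [q = f (2 a) (- a) / a]. Left-symmetry with [L_(2a)] and [L_(-2a)] shows that
    [f (2 a) (- a)] and [f (- (2 a)) a] have product [- a^2]; the sl2 relations then govern [f a a]
    and [f (- a) (- a)]. *)
Lemma f_multiples a : G a -> a != 0 -> exists q, [/\ q != 0,
  f a a * (3%:R + q) = 2%:R * a,
  f (- a) (- a) * (3%:R * q + 1) = - (2%:R * a * q),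
  f (2%:R * a) (- a) = a * q
  & f (- (2%:R * a)) a = - (a / q)].
Proof.
move=> Ga a0; have GNa : G (- a) by in_group.
have G2 : G (2%:R * a) by in_group.
have GN2 : G (- (2%:R * a)) by in_group.
have r00 : f a 0 = 0 by rewrite f_r0_eq0.
have s1 : f a a * f (- a) (2%:R * a) = 2%:R * a ^+ 2.
  rewrite (@sl2_relation a a 0 (2%:R * a)) //; try ring.
  by rewrite r00; ring.
have s2 : f a (2%:R * a) * f (- a) (3%:R * a) = 6%:R * a ^+ 2.
  rewrite (@sl2_relation a (2%:R * a) a (3%:R * a)) //; try ring.
  by rewrite [f (- a) _ * _]mulrC s1; ring.
have s3 : 3%:R * a * f a a = f (2%:R * a) a * f (- a) (3%:R * a).
  have := @left_symmetry (- a) (2%:R * a) a a (3%:R * a) 0 GNa G2 Ga.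
  move=> /(_ ltac:(ring) ltac:(ring) ltac:(ring)).
  by rewrite (f_r0_eq0 G2) mulr0 subr0 => <-; ring.
have s5 : 3%:R * a * f (- a) (2%:R * a) =
    f a (2%:R * a) * f (- (2%:R * a)) (3%:R * a).
  have := @left_symmetry a (- (2%:R * a)) (2%:R * a) (- a) 0 (3%:R * a)
    Ga GN2 G2.
  move=> /(_ ltac:(ring) ltac:(ring) ltac:(ring)).
  rewrite r00 mulr0 sub0r => E.
  by apply: (lincomb1 (-1) E); ring.
have s6 : f (2%:R * a) a * f (- (2%:R * a)) (3%:R * a) =
    f (- (2%:R * a)) a * f (2%:R * a) (- a) + 4%:R * a ^+ 2.
  rewrite (@sl2_relation (2%:R * a) a (- a) (3%:R * a)) //; ring.
have s6' : f (2%:R * a) a * f (- (2%:R * a)) (3%:R * a) = 3%:R * a ^+ 2.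
  have n0 : 6%:R * a ^+ 2 != 0 by rewrite mulf_neq0 ?expf_neq0 ?pnatr_eq0.
  apply: (mulfI n0); rewrite -{1}s2.
  (* In the product of [s3] and [s5], all other factors are evaluated by [s1] and [s2]. *)
  transitivity ((3%:R * a * f a a) * (3%:R * a * f (- a) (2%:R * a))).
    by rewrite s3 s5; ring.
  by apply: (lincomb1 (9%:R * a ^+ 2) s1); ring.
have s7 : f (- (2%:R * a)) a * f (2%:R * a) (- a) = - a ^+ 2.
  by apply: (lincomb2 (-1) 1 s6 s6'); ring.
have s1' : f (- a) (- a) * f a (- (2%:R * a)) = 2%:R * a ^+ 2.
  have := @sl2_relation (- a) (- a) 0 (- (2%:R * a)) GNa GNa.
  move=> /(_ ltac:(ring) ltac:(ring)); rewrite opprK (f_r0_eq0 GNa) => ->.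
  ring.
have sw1 := f_swap GNa G2; have sw2 := f_swap Ga GN2.
have qa : f (2%:R * a) (- a) != 0.
  apply/eqP => z; move: s7; rewrite z mulr0 => /esym/eqP.
  by rewrite oppr_eq0 (negPf (expf_neq0 2 a0)).
set Q := f (2%:R * a) (- a) in qa s7 sw1 *.
have Q2 : f (- (2%:R * a)) a = - a ^+ 2 / Q by rewrite -s7; field.
have e1 : f (- a) (2%:R * a) = Q + 3%:R * a by rewrite sw1; ring.
have e2 : f a (- (2%:R * a)) = - a ^+ 2 / Q - 3%:R * a.
  by apply: (lincomb2 (-1) 1 sw2 Q2); ring.
rewrite e1 in s1; rewrite e2 in s1'.
exists (Q / a); split.
- by rewrite mulf_neq0 ?invr_eq0.
- apply: (mulfI a0); apply: (lincomb1 1 s1).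
  by field.
- apply: (mulfI (expf_neq0 2 a0)); apply: (lincomb1 (- Q) s1').
  by field; rewrite a0 qa.
- by field.
- by rewrite Q2; field; rewrite a0 qa.
Qed.

(** The degree-zero identity for [(- a, 2 a)] and [(a, - 2 a)], with [f (- a) (- a)] and [f a a]
    eliminated. *)
Lemma degree0_form_multiples v a q : degree0_form v -> G a -> a != 0 ->
  q != 0 -> f a a * (3%:R + q) = 2%:R * a ->
  f (- a) (- a) * (3%:R * q + 1) = - (2%:R * a * q) ->
  f (2%:R * a) (- a) = a * q -> f (- (2%:R * a)) a = - (a / q) ->
  2%:R * q * v (2%:R * a) = (3%:R * q + 1) * (3%:R * v a - q * v (- a)) /\
  2%:R * q * v (- (2%:R * a)) = (3%:R + q) * (3%:R * q * v (- a) - v a).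
Proof.
move=> Hv Ga a0 q0 h1 h2 h3 h4; have GNa : G (- a) by in_group.
have := Hv (- a) (2%:R * a) (- a) a GNa ltac:(in_group) ltac:(ring) ltac:(ring).
have := Hv a (- (2%:R * a)) a (- a) Ga ltac:(in_group) ltac:(ring) ltac:(ring).
rewrite h3 h4 => E1 E2; split; apply: (mulfI a0).
  apply: (lincomb2 (v (2%:R * a)) (- (3%:R * q + 1)) h2 E2).
  by ring.
apply: (lincomb2 (- q * v (- (2%:R * a))) (q * (3%:R + q)) h1 E1).
by field.
Qed.

(** * Values of [F] and of the cubic form [U] *)

Section Extension.
Variable psi : C -> C -> C.
Hypothesis Hpsi : virasoro_ext_form G f psi.

Local Notation F := (antidiag f).

(* A combination of the two degree-zero forms for which the skew part is the
   pure cube. *)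
Definition cubic_form (x : C) := 24%:R * antidiag psi x + F x.
Local Notation U := cubic_form.

Lemma degree0_form_U : degree0_form U.
Proof.
move=> a b c d Ga Gb cE dE.
have E1 := degree0_form_f Ga Gb cE dE.
have E2 := degree0_form_ext Hpsi Ga Gb cE dE.
by apply: (lincomb2 1 24%:R E1 E2); rewrite /U; ring.
Qed.

Lemma U_swap a : G a -> U (- a) = U a + 2%:R * a ^+ 3.
Proof.
move=> Ga; rewrite /U antidiag_f_swap // (antidiag_ext_swap Hpsi) //.
by field.
Qed.

(** The skew parts turn the two relations of [degree0_form_multiples] into expressions for the same
    value at [2 a]; equating them gives a linear equation with coefficient [(1 - q) (1 + q)]. The
    equation for [F] is inconsistent at [q = 1], the one for [U] at [q = -1]. *)
Lemma FU_values a : G a -> a != 0 -> exists q,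
  [/\ q != 0, 1 - q != 0 & 1 + q != 0] /\
  [/\ F a = 2%:R * a * q / (1 - q), U a = - (2%:R * a ^+ 3 * q / (1 + q))
    & F (2%:R * a) = 2%:R * a * (3%:R * q + 1) / (1 - q)].
Proof.
move=> Ga a0; have [q [q0 h1 h2 h3 h4]] := f_multiples Ga a0.
have G2 : G (2%:R * a) by in_group.
have [F2 FN2] := degree0_form_multiples degree0_form_f Ga a0 q0 h1 h2 h3 h4.
have [U2 UN2] := degree0_form_multiples degree0_form_U Ga a0 q0 h1 h2 h3 h4.
rewrite !antidiag_f_swap // in F2 FN2.
rewrite !U_swap // in U2 UN2.
have EF : (1 - q) * (1 + q) * F a = 2%:R * a * q * (1 + q).
  apply: (mulfI (x := 6%:R)); first by rewrite pnatr_eq0.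
  by apply: (lincomb2 (-1) 1 F2 FN2); ring.
have EU : (1 - q) * (1 + q) * U a = - (2%:R * a ^+ 3 * q * (1 - q)).
  apply: (mulfI (x := 6%:R)); first by rewrite pnatr_eq0.
  by apply: (lincomb2 (-1) 1 U2 UN2); ring.
have two0 : (2%:R : C) != 0 by rewrite pnatr_eq0.
have q1 : 1 - q != 0.
  apply/eqP => /subr0_eq q1; move: EF; rewrite -q1 subrr !mul0r => /esym/eqP.
  by rewrite mulr1 mulf_eq0 (negPf (natr_mul_neq0 1 a0)) (negPf two0).
have q2 : 1 + q != 0.
  apply/eqP => q2; move: EU; rewrite q2 mulr0 mul0r => /esym/eqP.
  have -> : q = - 1 by apply: (lincomb1 1 q2); ring.
  have -> : - (2%:R * a ^+ 3 * -1 * (1 - -1)) = 4%:R * a ^+ 3 by ring.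
  by rewrite mulf_eq0 pnatr_eq0 expf_eq0 /= (negPf a0).
have vF : F a = 2%:R * a * q / (1 - q).
  apply: (mulfI (mulf_neq0 q1 q2)); rewrite EF; field; exact: q1.
exists q; split=> //; split=> //.
  apply: (mulfI (mulf_neq0 q1 q2)); rewrite EU; field; exact: q2.
apply: (mulfI (mulf_neq0 two0 q0)); rewrite F2 vF; field; exact: q1.
Qed.

(** * The slope of [F], which is [theta] at nonzero points of [V_(0,theta)] *)

Definition slope (x : C) := (F x + x) / x ^+ 2.
Local Notation T := slope.

Definition slope_ratio (x : C) := x / T x.
Local Notation rho := slope_ratio.

Lemma T_neq0 a : G a -> a != 0 -> T a != 0.
Proof.
move=> Ga a0; have [q [[q0 q1 q2] [vF _ _]]] := FU_values Ga a0.
rewrite /T vF (_ : _ / _ = (1 + q) / ((1 - q) * a)).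
  by rewrite !mulf_neq0 ?invr_eq0 ?mulf_neq0.
by field; rewrite a0 q1.
Qed.

Lemma F_T a : a != 0 -> F a = - (a * (1 - T a * a)).
Proof. by move=> a0; rewrite /T; field. Qed.

Lemma F_neq0 a : G a -> a != 0 -> F a != 0.
Proof.
move=> Ga a0; have [q [[q0 q1 q2] [vF _ _]]] := FU_values Ga a0.
by rewrite vF !mulf_neq0 ?invr_eq0 ?pnatr_eq0.
Qed.

(** Thus [(F, U)] at [a] is [F a] times [(1, - rho a)], so that wedging two of its values produces
    differences of [rho]. *)
Lemma U_rho a : G a -> a != 0 -> U a = - (rho a * F a).
Proof.
move=> Ga a0; have [q [[q0 q1 q2] [vF vU _]]] := FU_values Ga a0.
rewrite /rho /T vF vU; field; rewrite a0 q1 /=.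
by rewrite (_ : _ + _ = a * (1 + q)) ?mulf_neq0 //; ring.
Qed.

Lemma T_opp a : G a -> T (- a) = T a.
Proof.
move=> Ga; rewrite /T sqrrN antidiag_f_swap //.
by congr (_ / _); ring.
Qed.

Lemma T_double a : G a -> a != 0 -> T (2%:R * a) = T a.
Proof.
move=> Ga a0; have [q [[q0 q1 q2] [vF _ v2]]] := FU_values Ga a0.
by rewrite /T vF v2; field; rewrite a0 q1.
Qed.

Lemma rho_opp a : G a -> rho (- a) = - rho a.
Proof. by move=> Ga; rewrite /rho T_opp // mulNr. Qed.

(* Wedge the degree-zero identity of the pair [(F, U)] with its value at [b]. *)
Lemma f_rho a b c d : G a -> G b -> a != 0 -> b != 0 -> a + b != 0 ->
  c = - (a + b) -> d = a + b ->
  f b c * (F a * (rho b - rho a)) = (b - a) * (F d * (rho b - rho d)).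
Proof.
move=> Ga Gb a0 b0 ab0 cE dE.
have E1 := degree0_form_f Ga Gb cE dE.
have E2 := degree0_form_U Ga Gb cE dE.
have Gd : G d by rewrite dE; in_group.
rewrite !U_rho // ?dE // -dE in E2.
by apply: (lincomb2 (- rho b) (-1) E1 E2); ring.
Qed.

(** * The squared ratio is a multiple of the square *)

Definition slope_ratio_sqr (x : C) := rho x ^+ 2.
Local Notation sigma := slope_ratio_sqr.

Lemma sigma_opp a : G a -> sigma (- a) = sigma a.
Proof. by move=> Ga; rewrite /sigma rho_opp // sqrrN. Qed.

(** For [x + y + z = 0], [f_rho] governs both [f y z] and [f z y], whose difference is known; this
    is [key], linear in [F]. Adding its instances at [(a, b, - d)] and at the negated triple leaves
    only the skew part of [F], and the mixed products of [rho] cancel. *)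
Lemma sigma_add a b d : G a -> G b -> a != 0 -> b != 0 -> a + b != 0 ->
  d = a + b ->
  (a ^+ 2 - b ^+ 2) * sigma d =
  a * (a + 2%:R * b) * sigma a - b * (2%:R * a + b) * sigma b.
Proof.
move=> Ga Gb a0 b0 ab0 dE; have d0 : d != 0 by rewrite dE.
have Gd : G d by rewrite dE; in_group.
have key x y z : G x -> G y -> G z -> x != 0 -> y != 0 -> z != 0 ->
    z = - (x + y) -> F x * ((z - y) * ((rho y - rho x) * (rho z - rho x))) =
    (rho y + rho z) * ((y - x) * F (- z) * (rho z - rho x)
                       - (z - x) * F (- y) * (rho y - rho x)).
  move=> Gx Gy Gz x0 y0 z0 zE.
  have xy0 : x + y != 0 by rewrite -oppr_eq0 -zE.
  have xz : x + z = - y by rewrite zE; ring.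
  have xz0 : x + z != 0 by rewrite xz oppr_eq0.
  have E1 := @f_rho x y z (- z) Gx Gy x0 y0 xy0 zE ltac:(rewrite zE; ring).
  have E2 := @f_rho x z y (- y) Gx Gz x0 z0 xz0 ltac:(rewrite zE; ring)
    ltac:(rewrite zE; ring).
  have E3 := f_swap Gy Gz.
  rewrite !rho_opp // E3 in E1 E2.
  by apply: (lincomb2 (rho z - rho x) (- (rho y - rho x)) E1 E2); ring.
have K1 := @key a b (- d) Ga Gb ltac:(in_group) a0 b0 ltac:(rewrite oppr_eq0 //)
  ltac:(rewrite dE //).
have K2 := @key (- a) (- b) d ltac:(in_group) ltac:(in_group) Gd
  ltac:(rewrite oppr_eq0 //) ltac:(rewrite oppr_eq0 //) d0
  ltac:(rewrite dE; ring).
rewrite !opprK !rho_opp // !antidiag_f_swap // in K1 K2.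
apply: (mulfI (x := 2%:R)); first by rewrite pnatr_eq0.
rewrite /sigma dE in K1 K2 *.
by apply: (lincomb2 (-1) (-1) K1 K2); ring.
Qed.

(** The relation [sigma_add] at [(a + b, a - b)] ties [sigma (2 a) = 4 sigma a] to [sigma (a + b)]
    and [sigma (a - b)], which its instances at [(a, b)] and [(a, - b)] express through [sigma a]
    and [sigma b]. *)
Lemma sigma_quadratic a b : G a -> G b -> a != 0 -> b != 0 ->
  sigma a * b ^+ 2 = sigma b * a ^+ 2.
Proof.
move=> Ga Gb a0 b0; have [/eqP|ne] := eqVneq (a ^+ 2) (b ^+ 2).
  rewrite eqf_sqr => /orP[] /eqP -> //; by rewrite sigma_opp // sqrrN.
have pq : (a - b) * (a + b) != 0 by rewrite -subr_sqr subr_eq0.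
move: (pq); rewrite mulf_eq0 negb_or => /andP[m0 p0].
have GNb : G (- b) by in_group.
have E1 := sigma_add Ga Gb a0 b0 p0 (erefl _).
have E2 := sigma_add Ga GNb a0 ltac:(rewrite oppr_eq0 //) m0 (erefl _).
have s2 : sigma (2%:R * a) = 4%:R * sigma a.
  by rewrite /sigma /rho T_double // -mulrA exprMn -natrX.
have E3 := @sigma_add (a + b) (a - b) (2%:R * a) ltac:(in_group)
  ltac:(in_group) p0 m0
  ltac:(rewrite (_ : _ + _ = 2%:R * a) ?natr_mul_neq0 //; ring) ltac:(ring).
rewrite s2 in E3; rewrite sigma_opp // in E2.
have n0 : 12%:R * a * b != 0 by rewrite !mulf_neq0 ?pnatr_eq0.
apply: (mulfI n0); apply: subr0_eq.
have E4 : (a ^+ 2 - b ^+ 2) * (((a + b) ^+ 2 - (a - b) ^+ 2) * (4%:R * sigma a))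
  = (a + b) * (3%:R * a - b) *
    (a * (a + 2%:R * b) * sigma a - b * (2%:R * a + b) * sigma b)
    - (a - b) * (3%:R * a + b) *
    (a * (a + 2%:R * - b) * sigma a - - b * (2%:R * a + - b) * sigma b).
  rewrite E3 -E1.
  have -> : a * (a + 2%:R * - b) * sigma a - - b * (2%:R * a + - b) * sigma b
    = (a ^+ 2 - b ^+ 2) * sigma (a - b) by rewrite -E2 sqrrN.
  by ring.
by apply: (lincomb1 (-1) E4); ring.
Qed.

Lemma T_sign a b : G a -> G b -> a != 0 -> b != 0 -> T b = T a \/ T b = - T a.
Proof.
move=> Ga Gb a0 b0; have E := sigma_quadratic Ga Gb a0 b0.
have Ta := T_neq0 Ga a0; have Tb := T_neq0 Gb b0.
have /eqP : T b ^+ 2 = T a ^+ 2.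
  apply: (mulfI (mulf_neq0 (expf_neq0 2 a0) (expf_neq0 2 b0))).
  have -> : a ^+ 2 * b ^+ 2 * T b ^+ 2 =
    T a ^+ 2 * T b ^+ 2 * (sigma a * b ^+ 2).
    by rewrite /sigma /rho; field; exact: Ta.
  by rewrite E /sigma /rho; field; exact: Tb.
by rewrite eqf_sqr => /orP[] /eqP; [left | right].
Qed.

(** * Constancy of the sign of the slope *)

Definition sl2_product (a y : C) := f (- a) y * f a (y - a).
Local Notation N := sl2_product.

(** [N a y] is the coefficient of [L_y] in [L_a (L_(-a) L_y)]; the relation says that
    [N a y - y^2 + a y], a Casimir value of sl2, is invariant under [y -> y + a]. *)
Lemma N_step a y : G a -> G y -> N a (y + a) = N a y + 2%:R * a * y.
Proof.
move=> Ga Gy.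
by rewrite /N -(sl2_relation Ga Gy (erefl _) (erefl _)) addrK mulrC.
Qed.

(** [e] and [e'] are the signs of the slopes at [y] and [y - a] relative to [T a]. Both factors of
    [N a y] come from [f_rho], and the values of [F] cancel in their product. *)
Lemma N_rho a y e e' : G a -> G y -> a != 0 -> y != 0 -> y - a != 0 ->
  T y = e * T a -> T (y - a) = e' * T a -> e ^+ 2 = 1 -> e' ^+ 2 = 1 ->
  N a y * ((e' * (y - a) - a) * (e * y + a)) =
  (y - 2%:R * a) * (y + a) * (e * y - a) * (e' * (y - a) + a).
Proof.
move=> Ga Gy a0 y0 ya0 Ty Tya ee ee'.
have Gya : G (y - a) by in_group.
have Ta := T_neq0 Ga a0.
have inv_sign (s : C) : s ^+ 2 = 1 -> s^-1 = s.
  move=> ss; have s0 : s != 0.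
    by apply: contraTneq (oner_neq0 C) => s0; rewrite -ss s0 expr0n eqxx.
  by apply: (mulfI s0); rewrite -expr2 ss mulfV.
have ra : rho a = a / T a by [].
have ry : rho y = e * y / T a by rewrite /rho Ty invfM (inv_sign e) //; ring.
have rya : rho (y - a) = e' * (y - a) / T a.
  by rewrite /rho Tya invfM (inv_sign e') //; ring.
have GNa : G (- a) by in_group.
have GNy : G (- y) by in_group.
have GNya : G (- (y - a)) by in_group.
have NN0 (x : C) : x != 0 -> - x != 0 by rewrite oppr_eq0.
have E1 := @f_rho (- (y - a)) (- a) y (- y) GNya GNa (NN0 _ ya0) (NN0 _ a0)
  ltac:(rewrite (_ : _ + _ = - y) ?NN0 //; ring) ltac:(ring) ltac:(ring).
have E2 := @f_rho (- y) a (y - a) (- (y - a)) GNy Ga (NN0 _ y0) a0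
  ltac:(rewrite (_ : _ + _ = - (y - a)) ?NN0 //; ring) ltac:(ring) ltac:(ring).
rewrite !rho_opp // ra ry rya in E1 E2.
have n0 : F (- (y - a)) * F (- y) != 0 by rewrite mulf_neq0 ?F_neq0 ?NN0.
apply: (mulfI n0).
have := congr2 *%R E1 E2; rewrite /N => E.
apply: (lincomb1 (T a ^+ 2) E); field; exact: Ta.
Qed.

Lemma N_pm a y : G a -> G y -> a != 0 -> y != 0 -> y - a != 0 -> y + a != 0 ->
  T y = T a -> T (y - a) = - T a ->
  N a y * y = (y - 2%:R * a) ^+ 2 * (y - a).
Proof.
move=> Ga Gy a0 y0 ya0 yp0 Ty Tya.
have := @N_rho a y 1 (-1) Ga Gy a0 y0 ya0.
rewrite mul1r mulN1r sqrrN expr1n => /(_ Ty Tya erefl erefl) E.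
by apply: (mulIf yp0); apply: (lincomb1 (-1) E); ring.
Qed.

Lemma N_mp a y : G a -> G y -> a != 0 -> y != 0 -> y - a != 0 ->
  y - 2%:R * a != 0 -> T y = - T a -> T (y - a) = T a ->
  N a y * (y - a) = y * (y + a) ^+ 2.
Proof.
move=> Ga Gy a0 y0 ya0 y2 Ty Tya.
have := @N_rho a y (-1) 1 Ga Gy a0 y0 ya0.
rewrite mul1r mulN1r sqrrN expr1n => /(_ Ty Tya erefl erefl) E.
by apply: (mulIf y2); apply: (lincomb1 (-1) E); ring.
Qed.

Lemma N_mm a y : G a -> G y -> a != 0 -> y != 0 -> y - a != 0 ->
  T y = - T a -> T (y - a) = - T a ->
  N a y * (y * (y - a)) = (y - 2%:R * a) ^+ 2 * (y + a) ^+ 2.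
Proof.
move=> Ga Gy a0 y0 ya0 Ty Tya.
have := @N_rho a y (-1) (-1) Ga Gy a0 y0 ya0.
rewrite mulN1r sqrrN expr1n => /(_ Ty Tya erefl erefl) E.
by apply: (lincomb1 1 E); ring.
Qed.

(** The letters are the signs at [y - a], [y], [y + a]. Such a pattern fixes [N a y] and
    [N a (y + a)], which conflicts with [N_step]. *)
Lemma T_no_mmm a y : G a -> G y -> a != 0 -> y != 0 -> y - a != 0 ->
  y + a != 0 -> T (y - a) = - T a -> T y = - T a -> T (y + a) = - T a -> False.
Proof.
move=> Ga Gy a0 y0 ym0 yp0 Tm Ty Tp.
have E1 := N_mm Ga Gy a0 y0 ym0 Ty Tm.
have := @N_mm a (y + a) Ga ltac:(in_group) a0 yp0; rewrite N_step // addrK.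
move=> /(_ y0 Tp Ty) E2.
have : 8%:R * a ^+ 5 = 0.
  by apply: (lincomb2 (- (y + a)) (y - a) E1 E2); ring.
by apply/eqP; rewrite mulf_neq0 ?expf_neq0 ?pnatr_eq0.
Qed.

Lemma T_no_pmp a y : G a -> G y -> a != 0 -> y != 0 -> y - a != 0 ->
  y + a != 0 -> y - 2%:R * a != 0 -> y + 2%:R * a != 0 ->
  T (y - a) = T a -> T y = - T a -> T (y + a) = T a -> False.
Proof.
move=> Ga Gy a0 y0 ym0 yp0 y2m y2p Tm Ty Tp.
have E1 := N_mp Ga Gy a0 y0 ym0 y2m Ty Tm.
have := @N_pm a (y + a) Ga ltac:(in_group) a0 yp0; rewrite N_step // addrK.
move=> /(_ y0 ltac:(rewrite (_ : _ + _ = y + 2%:R * a) //; ring) Tp Ty) E2.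
have : 8%:R * (a * y ^+ 3) = 0.
  by apply: (lincomb2 (- (y + a)) (y - a) E1 E2); ring.
by apply/eqP; rewrite !mulf_neq0 ?expf_neq0 ?pnatr_eq0.
Qed.

Lemma T_no_pmm a y : G a -> G y -> a != 0 -> y != 0 -> y - a != 0 ->
  y + a != 0 -> y - 2%:R * a != 0 -> y + 2%:R * a != 0 ->
  T (y - a) = T a -> T y = - T a -> T (y + a) = - T a -> False.
Proof.
move=> Ga Gy a0 y0 ym0 yp0 y2m y2p Tm Ty Tp.
have Gp : G (y + a) by in_group.
have Gpp : G (y + a + a) by in_group.
have ypp0 : y + a + a != 0 by rewrite (_ : _ + a = y + 2%:R * a) //; ring.
have E1 := N_mp Ga Gy a0 y0 ym0 y2m Ty Tm.
have := @N_mm a (y + a) Ga Gp a0 yp0; rewrite N_step // addrK.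
move=> /(_ y0 Tp Ty) E2.
(* For the pattern [+ - -], comparing [N] at [y] and [y + a] leaves only a quartic, so the sign at
   [y + 2 a] is brought in. *)
have quartic : y ^+ 4 + 2%:R * a * y ^+ 3 - 2%:R * a ^+ 3 * y + a ^+ 4 = 0.
  apply: (mulfI (x := 4%:R * a)); first exact: (natr_mul_neq0 3 a0).
  by apply: (lincomb2 (- (y * (y + a))) (y - a) E1 E2); ring.
case: (T_sign Ga Gpp a0 ypp0) => Tpp; last first.
  by apply: (@T_no_mmm a (y + a)) => //; rewrite addrK.
(* [N_pm] at [y + 2 a] needs [y + 3 a] nonzero; the quartic rules out [y = - 3 a]. *)
have [y3|y3] := eqVneq (y + a + a + a) 0.
  have yE : y = - (3%:R * a) by apply: (lincomb1 1 y3); ring.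
  move: quartic; rewrite yE => E; have : 34%:R * a ^+ 4 = 0.
    by apply: (lincomb1 1 E); ring.
  by apply/eqP; rewrite mulf_neq0 ?expf_neq0 ?pnatr_eq0.
have := @N_pm a (y + a + a) Ga Gpp a0 ypp0.
rewrite !N_step // addrK => /(_ yp0 y3 Tpp Tp) E3.
have : (2%:R * y + a) * (y ^+ 2 + a * y - a ^+ 2) = 0.
  apply: (mulfI (x := 4%:R * a)); first exact: (natr_mul_neq0 3 a0).
  by apply: (lincomb2 (- (y + 2%:R * a)) (y - a) E1 E3); ring.
move/eqP; rewrite mulf_eq0 => /orP[] /eqP z.
  have aE : a = - (2%:R * y) by apply: (lincomb1 1 z); ring.
  move: quartic; rewrite aE => E; have : 29%:R * y ^+ 4 = 0.
    by apply: (lincomb1 1 E); ring.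
  by apply/eqP; rewrite mulf_neq0 ?expf_neq0 ?pnatr_eq0.
(* The quartic equals [(y^2 + a y) (y^2 + a y - a^2) - a^3 (y - a)]. *)
have : a ^+ 3 * (y - a) = 0.
  by apply: (lincomb2 (-1) (y ^+ 2 + a * y) quartic z); ring.
by apply/eqP; rewrite mulf_neq0 ?expf_neq0.
Qed.

Lemma T_const a b : G a -> G b -> a != 0 -> b != 0 -> T b = T a.
Proof.
move=> Ga Gb a0 b0; case: (T_sign Ga Gb a0 b0) => // Tb.
have Ta : T a != - T a.
  rewrite -subr_eq0 opprK -mulr2n -mulr_natl.
  by rewrite mulf_neq0 ?pnatr_eq0 ?T_neq0.
have GNa : G (- a) by in_group.
have Na0 : - a != 0 by rewrite oppr_eq0.
have TNa : T (- a) = T a by exact: T_opp.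
have G2 : G (2%:R * a) by in_group.
(* The slope is [T a] at [a], [- a], [2 a] and [- 2 a], so [b] is none of these. *)
have ne c : T c = T a -> b - c != 0.
  by move=> Tc; apply: contraNneq Ta => /subr0_eq bc; rewrite -Tb bc Tc.
have m0 : b - a != 0 by exact: ne.
have p0 : b + a != 0 by rewrite -(opprK a) ne.
have m2 : b - 2%:R * a != 0 by rewrite ne ?T_double.
have p2 : b + 2%:R * a != 0 by rewrite -[_ * a]opprK ne ?T_opp ?T_double.
have [Gm Gp] : G (b - a) /\ G (b + a) by split; in_group.
case: (T_sign Ga Gm a0 m0) (T_sign Ga Gp a0 p0) => Tm [] Tp; exfalso.
- exact: (@T_no_pmp a b).
- exact: (@T_no_pmm a b).
(* The pattern [- - +] is [+ - -] read in the direction [- a]. *)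
- by apply: (@T_no_pmm (- a) b); rewrite ?TNa ?mulrN ?opprK.
- exact: (@T_no_mmm a b).
Qed.

(** * Identification of [f] and uniqueness of the form *)

Lemma f_V0 g b c : G g -> g != 0 -> G b -> G c -> f b c = V0 (T g) b c.
Proof.
move=> Gg g0; set t := T g.
have Tt x : G x -> x != 0 -> T x = t by move=> Gx x0; exact: T_const.
have t0 : t != 0 by exact: T_neq0.
(* [1 + t * x] is a factor of [F (- x)], which is nonzero when [x] is. *)
have D x : G x -> 1 + t * x != 0.
  move=> Gx; have [->|x0] := eqVneq x 0; first by rewrite mulr0 addr0 oner_neq0.
  have Nx0 : - x != 0 by rewrite oppr_eq0.
  have := F_neq0 (GN Gx) Nx0; rewrite F_T // Tt; [|in_group|by []].
  by rewrite oppr_eq0 mulf_eq0 negb_or mulrN opprK => /andP[].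
have FE x : G x -> x != 0 -> F x = - (x * (1 - t * x)).
  by move=> Gx x0; rewrite F_T // Tt.
have rE x : G x -> x != 0 -> rho x = x / t by move=> Gx x0; rewrite /rho Tt.
(* [f_rho] at [- (x + y)] and [x] carries the factor [rho x + rho (x + y) = (2 x + y) / t], whose
   zero is excluded here. *)
have gen x y : G x -> G y -> x != 0 -> y != 0 -> x + y != 0 ->
    2%:R * x + y != 0 -> f x y = V0 t x y.
  move=> Gx Gy x0 y0 xy0 xxy0.
  have Nxy0 : - (x + y) != 0 by rewrite oppr_eq0.
  have Ny0 : - y != 0 by rewrite oppr_eq0.
  have GNxy : G (- (x + y)) by in_group.
  have GNy : G (- y) by in_group.
  have := @f_rho (- (x + y)) x y (- y) GNxy Gx Nxy0 x0
    ltac:(rewrite (_ : _ + _ = - y) //; ring) ltac:(ring) ltac:(ring).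
  rewrite !FE // !rE // => E.
  have Dxy := D _ (GD Gx Gy).
  apply: (mulIf (mulf_neq0 (mulf_neq0 xy0 Dxy) xxy0)).
  apply: (mulIf (invr_neq0 t0)).
  rewrite /V0; apply: (lincomb1 1 E).
  by field; rewrite t0 Dxy.
move=> Gb Gc; have [->|c0] := eqVneq c 0.
  by rewrite f_r0_eq0 // /V0 !mul0r.
have [->|b0] := eqVneq b 0.
  by rewrite f_0l_id // /V0 add0r mulfK // D.
have [bc0|bc0] := eqVneq (b + c) 0.
  have cE : c = - b by apply: (lincomb1 1 bc0); ring.
  rewrite /V0 bc0 mulr0 addr0 cE -/(antidiag f b) FE //.
  by rewrite divr1; ring.
have [bbc0|bbc0] := eqVneq (2%:R * b + c) 0; last exact: gen.
(* The excluded case is recovered from [f c b], because [2 c + b = - 3 b] is nonzero. *)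
have cE : c = - (2%:R * b) by apply: (lincomb1 1 bbc0); ring.
rewrite f_swap // gen //; last 2 first.
- by rewrite addrC.
- by rewrite cE (_ : _ + b = - (3%:R * b)) ?oppr_eq0 ?natr_mul_neq0 //; ring.
have := D _ (GD Gb Gc); rewrite /V0 (addrC c b) cE => Dbc.
by field.
Qed.

(** [F] would vanish at the inverse slope. *)
Lemma inv_T_notin g : G g -> g != 0 -> ~ G (T g)^-1.
Proof.
move=> Gg g0 Gd; have t0 := T_neq0 Gg g0.
have d0 : (T g)^-1 != 0 by rewrite invr_eq0.
have := F_neq0 Gd d0; rewrite F_T // (T_const Gg Gd) //.
by rewrite mulfV // subrr mulr0 oppr0 eqxx.
Qed.

Lemma ext_form_00 g : G g -> g != 0 -> psi 0 0 = 0.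
Proof.
move=> Gg g0; have := degree0_form_ext Hpsi Gg G0 (erefl _) (erefl _).
rewrite !addr0 f_0l_id; last by in_group.
have -> : antidiag psi 0 = psi 0 0 by rewrite /antidiag oppr0.
rewrite -/(antidiag f g) => E.
by apply: (mulfI (F_neq0 Gg g0)); apply: (lincomb1 1 E); ring.
Qed.

Lemma antidiag_ext (theta a : C) : theta != 0 -> G a -> a != 0 ->
  F a = - (a * (1 - theta * a)) ->
  antidiag psi a = 24%:R^-1 * a * (1 - theta * a) * (1 + a / theta).
Proof.
move=> t0 Ga a0 Fa.
have Ta : T a = theta by rewrite /T Fa; field.
have := U_rho Ga a0; rewrite /U /rho Ta Fa => E.
apply: (mulfI (x := 24%:R)); first by rewrite pnatr_eq0.
by apply: (lincomb1 1 E); field.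
Qed.

(** Condition (i) with [L_0] reduces [psi b c] to [psi 0 (b + c)]. It also kills [psi (b + c) 0],
    and condition (ii) is symmetric off degree zero. *)
Lemma ext_offdiag b c : G b -> G c -> b + c != 0 -> psi b c = 0.
Proof.
have [Gi sk] := Hpsi.
have E x y : G x -> G y -> (x + y) * psi x y = f x y * psi 0 (x + y).
  move=> Gx Gy; have := Gi 0 x y G0 Gx Gy.
  rewrite !add0r addr0 f_r0_eq0 // !f_0l_id // => E.
  by apply: (lincomb1 1 E); ring.
move=> Gb Gc bc0; apply: (mulfI bc0); rewrite E //.
set d := b + c in bc0 *; have Gd : G d by rewrite /d; in_group.
have E0 := E d 0 Gd G0; rewrite addr0 f_r0_eq0 // mul0r in E0.
have := sk 0 d G0 Gd; rewrite /delta0 add0r (negPf bc0) mulr0 => /subr0_eq ->.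
by move/eqP: E0; rewrite mulf_eq0 (negPf bc0) /= => /eqP ->; rewrite !mulr0.
Qed.

End Extension.

Lemma ext_unique (g theta : C) psi : G g -> g != 0 -> theta != 0 ->
  (forall b c, G b -> G c -> f b c = V0 theta b c) ->
  virasoro_ext_form G f psi ->
  forall a b, G a -> G b -> psi a b = phi_theta theta a b.
Proof.
move=> Gg g0 t0 fE Hpsi a b Ga Gb; rewrite /phi_theta /delta0.
have [ab0|ab0] := eqVneq (a + b) 0; last by rewrite mulr0 (ext_offdiag Hpsi).
have bE : b = - a by apply: (lincomb1 1 ab0); ring.
rewrite mulr1 bE; have [->|a0] := eqVneq a 0.
  by rewrite oppr0 (ext_form_00 Hpsi Gg g0); ring.
rewrite -/(antidiag psi a) (antidiag_ext Hpsi t0) //; first by field.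
rewrite /antidiag fE //; last by in_group.
by rewrite /V0 subrr mulr0 addr0 divr1; ring.
Qed.

End TrivialRightAction.

(** * Existence of the form for [V_(0,theta)] *)

Lemma V0_denom_neq0 (theta x : C) :
  theta != 0 -> ~ G theta^-1 -> G x -> 1 + theta * x != 0.
Proof.
move=> t0 nG Gx; apply/eqP => E; apply: nG.
rewrite (_ : theta^-1 = - x); first by in_group.
by apply: (mulfI t0); apply: (lincomb1 1 E); rewrite mulfV //; ring.
Qed.

Lemma phi_theta_ext (theta : C) psi : theta != 0 -> ~ G theta^-1 ->
  (forall b c, G b -> G c -> f b c = V0 theta b c) ->
  (forall a b, G a -> G b -> psi a b = phi_theta theta a b) ->
  virasoro_ext_form G f psi.
Proof.
move=> t0 nG fE pE; have D x := @V0_denom_neq0 theta x t0 nG.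
split=> [a b c Ga Gb Gc | a b Ga Gb].
  have [Gab Gbc Gac] : [/\ G (a + b), G (b + c) & G (a + c)] by split; in_group.
  have Gba : G (b + a) by in_group.
  rewrite !fE // !pE // /phi_theta /delta0 /V0.
  have -> : b + a + c = a + b + c by ring.
  have -> : a + (b + c) = a + b + c by ring.
  have -> : b + (a + c) = a + b + c by ring.
  have [abc0|abc0] := eqVneq (a + b + c) 0; last by rewrite !mulr0.
  have cE : c = - (a + b) by apply: (lincomb1 1 abc0); ring.
  have Dab := D _ Gab; have Dbc := D _ Gbc; have Dac := D _ Gac.
  rewrite cE in Dbc Dac *; field.
  by rewrite t0 Dac (addrC b a) Dab Dbc.
rewrite !pE // /phi_theta /delta0 (addrC b a).
have [ab0|ab0] := eqVneq (a + b) 0; last by rewrite !mulr0 subrr.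
have bE : b = - a by apply: (lincomb1 1 ab0); ring.
by rewrite bE; field.
Qed.

End GradedCLSAS.

(** * The finitely generated group and the equivalence *)

Lemma inG0 (C : numClosedFieldType) nu (g : 'I_nu -> C) : inG g 0.
Proof. by exists (fun=> 0); rewrite big1. Qed.

Lemma inGD (C : numClosedFieldType) nu (g : 'I_nu -> C) a b :
  inG g a -> inG g b -> inG g (a + b).
Proof.
move=> [m ->] [n ->]; exists (fun i => m i + n i).
by rewrite -big_split; apply: eq_bigr => i _; rewrite mulrzDr.
Qed.

Lemma inGN (C : numClosedFieldType) nu (g : 'I_nu -> C) a :
  inG g a -> inG g (- a).
Proof.
move=> [m ->]; exists (fun i => - m i).
by rewrite -sumrN; apply: eq_bigr => i _; rewrite mulrNz.
Qed.

Lemma inG_exists_neq0 (C : numClosedFieldType) nu (g : 'I_nu -> C) :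
  (0 < nu)%N -> Zfree g -> exists x, inG g x /\ x != 0.
Proof.
move=> nu0 free; pose i0 := Ordinal nu0; pose n i : int := (i == i0)%:R.
exists (\sum_(i < nu) g i *~ n i); split; first by exists n.
by apply/eqP => /free/(_ i0); rewrite /n eqxx.
Qed.

Theorem theorem5p1 (C : numClosedFieldType) (nu : nat) (g : 'I_nu -> C)
    (Hnu : (1 < nu)%N) (Hfree : Zfree g) (f : C -> C -> C)
    (HW : graded_CLSAS (inG g) f) :
  ((exists psi : C -> C -> C, virasoro_ext_form (inG g) f psi) <->
   (exists theta : C, theta != 0 /\ ~ inG g theta^-1 /\
      forall b c, inG g b -> inG g c -> f b c = V0 theta b c))
  /\
  (forall theta : C, theta != 0 -> ~ inG g theta^-1 ->
     (forall b c, inG g b -> inG g c -> f b c = V0 theta b c) ->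
     forall psi : C -> C -> C,
       virasoro_ext_form (inG g) f psi <->
       (forall a b, inG g a -> inG g b -> psi a b = phi_theta theta a b)).
Proof.
have G0 := inG0 g; have GD := @inGD C nu g; have GN := @inGN C nu g.
have [x [Gx x0]] := inG_exists_neq0 (ltnW Hnu) Hfree.
split; first split.
- move=> [psi Hpsi].
  have f00 := f_00 G0 GD GN HW Hpsi Gx x0.
  have fr0 b : inG g b -> f b 0 = 0.
    by move=> Gb; case: (f_r0 G0 GD HW Gb) => ->.
  (* By [T_const], any nonzero element of the group yields the same parameter. *)
  exists (slope f x); split; [|split].
  + exact: (T_neq0 G0 GD GN HW fr0 Hpsi).
  + exact: (inv_T_notin G0 GD GN HW fr0 Hpsi).
  + by move=> b c; exact: (f_V0 G0 GD GN HW fr0 Hpsi).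
- move=> [theta [t0 [nG fE]]]; exists (phi_theta theta).
  by apply: (phi_theta_ext GD GN t0 nG fE).
move=> theta t0 nG fE psi; split; last exact: (phi_theta_ext GD GN t0 nG fE).
have fr0 b : inG g b -> f b 0 = 0 by move=> Gb; rewrite fE // /V0 !mul0r.
exact: (ext_unique G0 GD GN HW fr0 Gx x0 t0 fE).
Qed.
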